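(* Let $X_1,\ldots,X_k,Y$ be topological vector spaces. For each $1\leq j\leq k$, let $\tau_j$ be a vector topology on $X_j$, coarser than or equal to the weak topology of $X_j$, and let $\mathcal{B}_j$ be a bornology on $X_j$ consisting of weakly bounded sets. Then a $k$-linear mapping from $X_1\times\cdots\times X_k$ into $Y$ is $\tau_j$-continuous on $\mathcal{B}_j$-sets if and only if it is uniformly $\tau_j$-continuous on $\mathcal{B}_j$-sets.
   Context: A family $\mathcal{B}$ of subsets of a vector space $X$ is a bornology if: (a) $\mathcal{B}$ covers $X$; (b) $A\in\mathcal{B}$, $D\subset A$ imply $D\in\mathcal{B}$; (c) $A,D\in\mathcal{B}$ imply $A\cup D\in\mathcal{B}$; (d) $A\in\mathcal{B}$ and $\lambda$ a scalar imply $\lambda A\in\mathcal{B}$; (e) $A,D\in\mathcal{B}$ imply $A+D\in\mathcal{B}$. $k$-linear mappings are not assumed continuous. A $k$-linear mapping $A:X_1\times\cdots\times X_k\to Y$ is $\tau_j$-continuous on $\mathcal{B}_j$-sets if for all $B_j\in\mathcal{B}_j$ and $x^j\in B_j$ $(1\leq j\leq k)$, and each zero neighbourhood $V$ in $Y$, there are $\tau_j$-zero neighbourhoods $U_j$ in $X_j$ such that $A(y^1,\ldots,y^k)-A(x^1,\ldots,x^k)\in V$ whenever $y^j\in B_j$ satisfy $y^j-x^j\in U_j$ for $1\leq j\leq k$. It is uniformly $\tau_j$-continuous on $\mathcal{B}_j$-sets if for all $B_j\in\mathcal{B}_j$ $(1\leq j\leq k)$ and each zero neighbourhood $V$ in $Y$,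 there are $\tau_j$-zero neighbourhoods $U_j$ in $X_j$ such that $A(y^1,\ldots,y^k)-A(x^1,\ldots,x^k)\in V$ whenever $x^j,y^j\in B_j$ satisfy $y^j-x^j\in U_j$ for $1\leq j\leq k$. *)

(* Defs.v *)
From HB Require Import structures.
From mathcomp Require Import all_boot all_order all_algebra.
From mathcomp Require Import complex.
From mathcomp Require Import all_classical all_reals all_analysis.

Set Implicit Arguments.
Unset Strict Implicit.
Unset Printing Implicit Defensive.

Import Order.TTheory GRing.Theory Num.Theory.
Import numFieldNormedType.Exports.

Local Open Scope classical_set_scope.
Local Open Scope ring_scope.

Definition real_or_complex (R : realType) (K : numFieldType) : Prop :=
  K = R :> numFieldType \/ K = complex R :> numFieldType.

(* A topology on a type [T], possibly other than the canonical one of [T], is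
   a structure [tau : Topological T], as for the argument of [sup_topology];
   [top_space tau] is [T] endowed with [tau]. *)
Definition top_space (T : Type) (tau : Topological T) : topologicalType :=
  Topological.Pack tau.

Section TopologicalVectorSpaces.
Context (K : numFieldType).

Section OneSpace.
Variable X : topologicalLmodType K.
Implicit Types (tau : Topological X) (B : set X) (BB : set (set X)).

Definition vector_topology tau : Prop :=
  continuous (fun p : top_space tau * top_space tau =>
                (p.1 : X) + (p.2 : X) : top_space tau) /\
  continuous (fun p : K^o * top_space tau =>
                p.1 *: (p.2 : X) : top_space tau).

Definition zero_nbhs tau : set_system X := @nbhs _ (top_space tau) (0 : X).

Definition dual : Type :=
  {f : {linear X -> K^o} | continuous (f : X -> K^o)}.

Definition weak_topology : Topological X :=
  Topological.on (sup_topology (fun f : dual =>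
    Topological.on (initial_topology (sval f : X -> K^o)))).

Definition coarser tau1 tau2 : Prop :=
  @open (top_space tau1) `<=` @open (top_space tau2).

Definition top_bounded tau B : Prop :=
  forall U, zero_nbhs tau U ->
    exists2 r : K, 0 < r & forall t : K, r <= `|t| -> B `<=` ( *:%R t) @` U.

Definition weakly_bounded B : Prop := top_bounded weak_topology B.

Definition bornology BB : Prop :=
  [/\ \bigcup_(A in BB) A = setT,
      forall A D, BB A -> D `<=` A -> BB D,
      forall A D, BB A -> BB D -> BB (A `|` D),
      forall (l : K) A, BB A -> BB [set l *: x | x in A] &
      forall A D, BB A -> BB D -> BB [set x + y | x in A & y in D]].

End OneSpace.

Section Multilinear.
Variables (k : nat) (X : 'I_k -> topologicalLmodType K).
Variable Y : topologicalLmodType K.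
Variable tau : forall j, Topological (X j).
Variable BB : forall j, set (set (X j)).
Variable A : (forall j, X j) -> Y.

(* [dfwith x j u] is the family [x] with its [j]-th component replaced by
   [u : X j]. *)
Definition multilinear : Prop :=
  forall (j : 'I_k) (x : forall i, X i),
    linear (fun u : X j => A (dfwith x j u)).

Definition continuous_on_sets : Prop :=
  forall B : forall j, set (X j), (forall j, BB (B j)) ->
  forall x : forall j, X j, (forall j, B j (x j)) ->
  forall V : set Y, nbhs 0 V ->
  exists2 U : forall j, set (X j), (forall j, zero_nbhs (tau j) (U j)) &
    forall y : forall j, X j, (forall j, B j (y j)) ->
      (forall j, U j (y j - x j)) -> V (A y - A x).

Definition unif_continuous_on_sets : Prop :=
  forall B : forall j, set (X j), (forall j, BB (B j)) ->
  forall V : set Y, nbhs 0 V ->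
  exists2 U : forall j, set (X j), (forall j, zero_nbhs (tau j) (U j)) &
    forall x y : forall j, X j, (forall j, B j (x j)) ->
      (forall j, B j (y j)) ->
      (forall j, U j (y j - x j)) -> V (A y - A x).

End Multilinear.
End TopologicalVectorSpaces.

(* Main.v *)
Require Import Defs.
From mathcomp Require Import all_boot all_order all_algebra.
From mathcomp Require Import complex lra.
From mathcomp Require Import all_classical all_reals all_analysis.
Import Order.TTheory GRing.Theory Num.Theory.
Import numFieldNormedType.Exports.

Set Implicit Arguments.
Unset Strict Implicit.
Unset Printing Implicit Defensive.

Local Open Scope classical_set_scope.
Local Open Scope ring_scope.

(** Uniform continuity follows from continuity because the sets of the
    bornologies are [tau j]-precompact.  A weakly bounded set has a bounded
    image under each continuous linear functional; bounded sets of real or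
    complex scalars are totally bounded; and weak zero neighbourhoods
    contain finite intersections of preimages of scalar ones.  So weakly bounded sets
    are weakly precompact ([weakly_bounded_precompact]), a fortiori for a
    coarser topology.

    By telescoping, [A y - A x] is a sum of [k] terms, each being a value of
    [A] at a family with one component [y i - x i] and the others taken in the
    [B j] ([small_difference]).  Each term has to be small once [y i - x i] is
    small, uniformly in the other components.  This is
    [small_in_some_variables]: if the components indexed by a nonempty set [S]
    are small then the value of [A] is small, the other components being
    either fixed or free in [B j].  Free variables are removed one at a time.
    Write a free component [z i] as [f + u], where [u] is small and [f] runs
    through a finite subset of [B i]: the value of [A] with [u] in place of
    [z i] has one more small variable, and the one with [f] has one more fixed
    variable, so that both have one free variable less.  When no variable is
    free, the claim is the continuity of [A] on sets at the point that is [0]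
    on [S] and takes the fixed values elsewhere, where [A] vanishes. *)

(** * Total boundedness in terms of finite colorings *)

(** Total boundedness stated through a coloring rather than through a finite
    net: refining two colorings amounts to pairing them, and a coloring pulls
    back along any map. *)
Definition finitely_colorable (T : Type) (B : set T) (E : T -> T -> Prop) :=
  exists (C : finType) (c : T -> C),
    forall x y, B x -> B y -> c x = c y -> E x y.

(** Precompactness of [B] is tested on one neighbourhood [U] at a time, so that
    those [U] that pass the test form a filter. *)
Definition precompact_for (V : zmodType) (B : set V) : set_system V :=
  [set U | finitely_colorable B (fun x y => U (x - y))].

(** The color of [x] is the index of the cell of length [e] that contains [x],
    counting from [- M]. *)
Lemma real_ball_colorable (R : realType) (M e : R) : 0 < e ->
  finitely_colorable [set x : R | `|x| <= M] (fun x y => `|x - y| < e).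
Proof.
move=> e0; pose q x := Num.truncn ((x + M) / e).
(* Cells are numbered up to that of [M], the quotient of [M + M] by [e]. *)
exists 'I_(Num.truncn ((M + M) / e)).+1, (fun x => inord (q x)) => x y /= xM yM.
move/(congr1 (fun i => nat_of_ord i)).
have qle z : `|z| <= M -> (q z < (Num.truncn ((M + M) / e)).+1)%N.
  rewrite ler_norml => /andP[_ zM]; rewrite ltnS; apply: le_truncn.
  by rewrite ler_pM2r ?invr_gt0// lerD2r.
rewrite !inordK ?qle// => qxy.
have bounds z : `|z| <= M -> (q z)%:R * e <= z + M < (q z)%:R * e + e.
  rewrite ler_norml => /andP[Mz _].
  have /truncn_itv : 0 <= (z + M) / e by rewrite divr_ge0 ?(ltW e0)//; lra.
  by rewrite ler_pdivlMr// ltr_pdivrMr// -natr1 [in ltRHS]mulrDl mul1r.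
have := bounds _ xM; have := bounds _ yM; rewrite qxy => /andP[? ?] /andP[? ?].
by rewrite ltr_norml; apply/andP; split; lra.
Qed.

Lemma complex_ball_colorable (R : realType) (M e : complex R) : 0 < e ->
  finitely_colorable
    [set x : complex R | `|x| <= M] (fun x y => `|x - y| < e).
Proof.
case: e => e e'; rewrite ltcE => /= /andP[/eqP -> e0].
(* As [`|x - y|] is at most the sum of the distances of the real parts and of
   the imaginary parts, a color for [e / 2] is recorded for each. *)
have e20 : 0 < e / 2 by rewrite divr_gt0.
have [C [c cP]] := real_ball_colorable (complex.Re M) e20.
have ReM z : `|z| <= M -> `|complex.Re z| <= complex.Re M.
  by move=> /(le_trans (normc_ge_Re z)); rewrite lecE => /andP[].
have ImM z : `|z| <= M -> `|complex.Im z| <= complex.Re M.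
  move=> zM; rewrite -normrN -ReiNIm; apply: ReM.
  by rewrite normrM [X in _ * X]normc_def/= expr0n expr1n add0r sqrtr1 mulr1.
exists (C * C)%type, (fun z => (c (complex.Re z), c (complex.Im z))).
move=> x y /= xM yM [cRe cIm].
have := cP _ _ (ReM _ xM) (ReM _ yM) cRe.
have := cP _ _ (ImM _ xM) (ImM _ yM) cIm.
move: x y {xM yM cRe cIm} => [x x'] [y y'] /= Im_lt Re_lt.
rewrite [X in `|X|]complexE /=.
apply: le_lt_trans (ler_normD _ _) _.
rewrite normrM 3!normc_def/= !expr0n expr1n add0r !addr0 sqrtr1 mul1r !sqrtr_sqr.
by rewrite -rmorphD ltcR/= (splitr e) ltrD.
Qed.

Lemma scalar_ball_colorable (R : realType) (K : numFieldType) (M e : K) :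
  real_or_complex R K -> 0 < e ->
  finitely_colorable [set x : K | `|x| <= M] (fun x y => `|x - y| < e).
Proof.
by case=> KE; subst K; [exact: real_ball_colorable|exact: complex_ball_colorable].
Qed.

Lemma precompact_for_filter (V : zmodType) (B : set V) :
  Filter (precompact_for B).
Proof.
split.
- by exists unit, (fun=> tt).
- move=> U W [C [c cP]] [D [d dP]].
  exists (C * D)%type, (fun x => (c x, d x)) => x y Bx By [cxy dxy].
  by split; [exact: cP|exact: dP].
- move=> U W UW [C [c cP]]; exists C, c => x y Bx By cxy.
  by apply: UW; exact: cP.
Qed.

(** Choosing a representative in each nonempty color class gives a finite net
    contained in [B]; the centers must lie in [B] because they will be used as
    values of the variables of a mapping controlled on [B] only. *)
Lemma precompact_for_cover (V : zmodType) (B U : set V) :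
  precompact_for B U ->
  exists2 s : seq V, {in s, forall f, B f} &
    forall x, B x -> exists2 f, f \in s & U (x - f).
Proof.
move=> [C [c cP]].
pose r (i : C) : option V :=
  if pselect (exists2 f, B f & c f = i) is left h then Some (sval (cid2 h))
  else None.
exists (pmap r (enum C)) => [f|x Bx].
  rewrite mem_pmap => /mapP[i _]; rewrite /r; case: pselect => // h [->].
  by case: cid2.
have [f rf] : exists f, r (c x) = Some f.
  by rewrite /r; case: pselect => [h|[]]; [eexists|exists x].
exists f; first by rewrite mem_pmap -rf map_f// mem_enum.
move: rf; rewrite /r; case: pselect => // h [<-]; case: cid2 => g /= Bg cg.
exact: cP.
Qed.

(** * Weakly bounded sets are weakly precompact *)

Section weak_topology.
Variables (R : realType) (K : numFieldType) (hK : real_or_complex R K).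
Variable X : topologicalLmodType K.

Lemma weak_nbhs_preimage (f : dual X) (O : set K^o) : nbhs (0 : K^o) O ->
  zero_nbhs (weak_topology X) (sval f @^-1` O).
Proof.
move=> O0.
have /cvg_sup/(_ f) weak_finer :
    nbhs (0 : top_space (weak_topology X)) --> (0 : top_space (weak_topology X)).
  exact: cvg_id.
apply: weak_finer; apply: (@initial_continuous _ _ (sval f)).
by rewrite linear0.
Qed.

Lemma weakly_bounded_dual (B : set X) (f : dual X) : weakly_bounded B ->
  exists M : K, forall x, B x -> `|sval f x| <= M.
Proof.
move=> bB.
have /bB[r r0 /(_ r)] : zero_nbhs (weak_topology X)
    (sval f @^-1` [set z : K^o | `|z| < 1]).
  apply: weak_nbhs_preimage.
  by apply/nbhs_ballP; exists 1 => //= z; rewrite /ball/= sub0r normrN.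
rewrite ger0_norm ?(ltW r0)// => /(_ (lexx r)) BU; exists r => x /BU[u /= fu <-].
rewrite linearZ normrM ger0_norm ?(ltW r0)// -[leRHS]mulr1.
by rewrite ler_wpM2l// ltW.
Qed.

(** The neighbourhoods for which [B] is precompact form a filter, and it
    converges to [0] in the weak topology as soon as it does so in each of the
    initial topologies of which the weak topology is the supremum.  Hence a
    single functional may be treated at a time. *)
Lemma weakly_bounded_precompact (B U : set X) : weakly_bounded B ->
  zero_nbhs (weak_topology X) U -> precompact_for B U.
Proof.
move=> bB.
have FF := precompact_for_filter B.
suff : precompact_for B --> (0 : top_space (weak_topology X)) by apply.
apply/cvg_sup => f W [_ [[G oG <-] /= G0] GW].
apply: filterS GW _.
have /nbhs_ballP[e /= e0 eO] : nbhs (0 : K^o) G.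
  by apply: open_nbhs_nbhs; split => //; move: G0; rewrite linear0.
have [M fM] := weakly_bounded_dual f bB.
have [C [c cP]] := scalar_ball_colorable M hK e0.
exists C, (c \o sval f) => x y Bx By cxy /=.
apply: eO; rewrite /ball/= sub0r normrN linearB.
by apply: cP => //; exact: fM.
Qed.

End weak_topology.

(** * Preliminaries on families, sums and bornologies *)

Lemma dfwith_all (I : eqType) (T : I -> Type) (P : forall j, T j -> Prop)
    (z : forall j, T j) (i : I) (u : T i) :
  P i u -> (forall j, j != i -> P j (z j)) -> forall j, P j (dfwith z i u j).
Proof. by move=> Pu Pz j; case: dfwithP => // l il; apply: Pz; rewrite eq_sym. Qed.

Lemma dfwith_id (I : eqType) (T : I -> Type) (z : forall j, T j) (i : I) :
  dfwith z i (z i) = z.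
Proof.
by apply: functional_extensionality_dep; exact: (@dfwith_all _ _ (fun j u => u = z j)).
Qed.

Lemma nbhs0_half (K : numFieldType) (Y : topologicalLmodType K) (V : set Y) :
  nbhs 0 V -> exists2 W : set Y, nbhs 0 W & forall a b, W a -> W b -> V (a + b).
Proof.
move=> V0; have := @add_continuous Y (0, 0).
rewrite /continuous_at/= addr0 => /(_ V V0)[ [W1 W2] /= [W10 W20] WV].
exists (W1 `&` W2) => [|a b [aW1 _] [_ bW2]]; first exact: filterI.
exact: (WV (a, b)).
Qed.

(** Families with some components in [B] and some equal to a difference of two
    points of [B] occur in both uses of multilinearity below; this set
    accommodates both kinds of components. *)
Definition with_differences (V : zmodType) (B : set V) : set V :=
  B `|` [set x - y | x in B & y in B].

Section bornology.
Variables (K : numFieldType) (X : topologicalLmodType K) (BB : set (set X)).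
Hypothesis born : bornology BB.

Lemma bornology_with_differences B : BB B -> BB (with_differences B).
Proof.
have [_ _ BU BZ BD] := born => BB_B; apply: BU => //.
have := BD _ _ BB_B (BZ (-1) _ BB_B).
congr BB; apply/seteqP; split => x /=.
- by move=> [a Ba [_ [b Bb <-] <-]]; exists a => //; exists b; rewrite ?scaleN1r.
- move=> [a Ba [b Bb <-]]; exists a => //; exists (- b) => //.
  by exists b; rewrite ?scaleN1r.
Qed.

Lemma bornology_addpoint B x : BB B -> BB (B `|` [set x]).
Proof.
have [BT Bsub BU _ _] := born => BB_B; apply: BU => //.
have : [set: X] x by [].
by rewrite -BT => -[D BB_D Dx]; apply: (Bsub _ _ BB_D) => _ ->.
Qed.

End bornology.

(** * Multilinear mappings continuous on precompact sets *)

Section multilinear.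
Context {K : numFieldType} {k : nat} {X : 'I_k -> topologicalLmodType K}
  {Y : topologicalLmodType K}.
Variables (tau : forall j, Topological (X j)) (BB : forall j, set (set (X j))).
Variable A : (forall j, X j) -> Y.
Arguments tau : clear implicits.
Arguments BB : clear implicits.
Hypothesis hA : multilinear A.

Lemma multilinearB (z : forall j, X j) (i : 'I_k) (u v : X i) :
  A (dfwith z i (u - v)) = A (dfwith z i u) - A (dfwith z i v).
Proof. by rewrite addrC -scaleN1r hA scaleN1r addrC. Qed.

Lemma multilinear0 (z : forall j, X j) (i : 'I_k) : z i = 0 -> A z = 0.
Proof.
by move=> zi; rewrite -(dfwith_id z i) zi -(subr0 0) multilinearB subrr.
Qed.

Hypothesis born : forall j, bornology (BB j).
Hypothesis precompact : forall j B U, BB j B -> zero_nbhs (tau j) U ->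
  precompact_for B U.
Hypothesis contA : continuous_on_sets tau BB A.

(** The indices in [S] are those of the small variables, the indices in [D] but
    not in [S] those of the free ones, and [p] gives the value of the remaining
    ones.  All of [S], [B] and [p] vary in the induction on [D]: when [z i] is
    split as [f + u], the index [i] joins [S] for the family with component
    [u], which is only known to lie in [with_differences (B i)], and [f]
    becomes the value of [p] at [i] for the other family. *)
Lemma small_in_some_variables (D : seq 'I_k) (S : {set 'I_k})
    (B : forall j, set (X j)) (p : forall j, X j) (V : set Y) :
  S != finset.set0 -> (forall j, BB j (B j)) -> nbhs 0 V ->
  exists2 U : forall j, set (X j), (forall j, zero_nbhs (tau j) (U j)) &
    forall z : forall j, X j, (forall j, B j (z j)) ->
      (forall j, j \in S -> U j (z j)) ->
      (forall j, j \notin S -> j \notin D -> z j = p j) -> V (A z).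
Proof.
elim: D S B p V => [|i D IH] S B p V S0 BB_B V0.
  pose x j := if j \in S then 0 else p j.
  have [i iS] := set0Pn _ S0.
  have Ax : A x = 0 by apply: (@multilinear0 _ i); rewrite /x iS.
  have [||U U0 UV] := @contA (fun j => B j `|` [set x j]) _ x _ V V0.
  - by move=> j; apply: bornology_addpoint; first exact: born.
  - by move=> j; right.
  exists U => // z Bz Uz zp.
  rewrite -[A z]subr0 -Ax; apply: UV => j; first by left.
  rewrite /x; case: ifPn => jS; first by rewrite subr0; exact: Uz.
  by rewrite zp// subrr; exact: nbhs_singleton (U0 j).
have [iS|iS] := boolP (i \in S).
  have [U U0 UV] := IH S B p V S0 BB_B V0.
  exists U => // z Bz Uz zp; apply: UV => // j jS jD; apply: zp => //.
  by rewrite inE (negPf jD) orbF; apply: contraNneq jS => ->.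
have [W W0 WV] := nbhs0_half V0.
have [|j|U1 U10 U1W] := IH (i |: S)%SET (fun j => with_differences (B j)) p W _ _ W0.
- by apply/set0Pn; exists i; rewrite !inE eqxx.
- by apply: bornology_with_differences; first exact: born.
have [s sB sU1] := precompact_for_cover (precompact (BB_B i) (U10 i)).
have /choice[U2 U2P] : forall f, exists U : forall j, set (X j),
    (forall j, zero_nbhs (tau j) (U j)) /\
    forall z : forall j, X j, (forall j, B j (z j)) ->
      (forall j, j \in S -> U j (z j)) ->
      (forall j, j \notin S -> j \notin D -> z j = dfwith p i f j) -> W (A z).
  by move=> f; have [U] := IH S B (dfwith p i f) W S0 BB_B W0; exists U.
exists (fun j => U1 j `&` \bigcap_(f in [set` s]) U2 f j) => [j|z Bz Uz zp].
  apply: filterI => //; rewrite bigcap_seq.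
  apply: (big_ind (zero_nbhs (tau j))) => [||f _]; [exact: filterT| |].
    by move=> ? ?; exact: filterI.
  by have [] := U2P f.
have [f fs fU1] := sU1 _ (Bz i).
have -> : A z = A (dfwith z i (z i - f)) + A (dfwith z i f).
  by rewrite multilinearB dfwith_id subrK.
apply: WV.
- apply: U1W => j.
  + apply: (@dfwith_all _ _ (fun j => with_differences (B j))) => [|l _]; last by left.
    by right; exists (z i) => //; exists f => //; exact: sB.
  + have [-> _|ji] := eqVneq j i; first by rewrite dfwithin.
    rewrite dfwithout 1?eq_sym// in_setU1 (negPf ji)/= => jS.
    by have [] := Uz j jS.
  + rewrite in_setU1 => /norP[ji jS] jD.
    by rewrite dfwithout 1?eq_sym// zp// inE negb_or ji.
- have [_] := U2P f; apply => j.
  + by apply: (@dfwith_all _ _ B) => [|l _]; [exact: sB|exact: Bz].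
  + move=> jS; rewrite dfwithout; last by apply: contraNneq iS => ->.
    by have [_] := Uz j jS; apply.
  + move=> jS jD; have [->|ji] := eqVneq j i; first by rewrite !dfwithin.
    by rewrite !dfwithout 1?eq_sym// zp// inE negb_or ji.
Qed.

(** Telescoping, by induction on a bound [n] on the indices where [x] and [y]
    differ: the intermediate point is [y] with its component of index [n]
    replaced by that of [x]. *)
Lemma small_difference (n : nat) (B : forall j, set (X j)) (V : set Y) :
  (forall j, BB j (B j)) -> nbhs 0 V ->
  exists2 U : forall j, set (X j), (forall j, zero_nbhs (tau j) (U j)) &
    forall x y : forall j, X j, (forall j, B j (x j)) ->
      (forall j, B j (y j)) -> (forall j, U j (y j - x j)) ->
      (forall j : 'I_k, (n <= j)%N -> y j = x j) -> V (A y - A x).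
Proof.
move=> BB_B; elim: n V => [|n IH] V V0.
  exists (fun=> setT) => [j|x y _ _ _ xy]; first exact: filterT.
  have -> : y = x by apply: functional_extensionality_dep => j; exact: xy.
  by rewrite subrr; exact: nbhs_singleton.
have [W W0 WV] := nbhs0_half V0.
have [U1 U10 U1W] := IH _ W0.
have [nk|kn] := ltnP n k; last first.
  exists U1 => // x y Bx By Uxy xy; rewrite -[_ - _]addr0.
  apply: WV; last exact: nbhs_singleton.
  apply: U1W => // j nj.
  by have := leq_trans kn nj; rewrite leqNgt ltn_ord.
pose i := Ordinal nk.
have [||U2 U20 U2W] := @small_in_some_variables (enum 'I_k) [set i]%SET
  (fun j => with_differences (B j)) (fun=> 0) W _ _ W0.
- by apply/set0Pn; exists i; rewrite inE.
- by move=> j; apply: bornology_with_differences; first exact: born.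
exists (fun j => U1 j `&` U2 j) => [j|x y Bx By Uxy xy]; first exact: filterI.
have -> : A y - A x =
    A (dfwith y i (y i - x i)) + (A (dfwith y i (x i)) - A x).
  by rewrite multilinearB dfwith_id addrA subrK.
apply: WV.
- apply: U2W => [|j|j _]; last by rewrite mem_enum.
  + apply: (@dfwith_all _ _ (fun j => with_differences (B j))) => [|l _]; last by left.
    by right; exists (y i) => //; exists (x i).
  + by rewrite inE => /eqP ->; rewrite dfwithin; have [] := Uxy i.
- apply: U1W => //.
  + exact: (@dfwith_all _ _ B).
  + apply: (@dfwith_all _ _ (fun j u => U1 j (u - x j))) => [|l _];
      last by have [] := Uxy l.
    by rewrite subrr; exact: nbhs_singleton (U10 i).
  + move=> j nj; have [->|ji] := eqVneq j i; first by rewrite dfwithin.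
    rewrite dfwithout 1?eq_sym//; apply: xy.
    by rewrite ltn_neqAle nj andbT eq_sym.
Qed.

Lemma continuous_unif_continuous : unif_continuous_on_sets tau BB A.
Proof.
move=> B BB_B V V0; have [U U0 UV] := small_difference k BB_B V0.
exists U => // x y Bx By Uxy; apply: UV => // j.
by rewrite leqNgt ltn_ord.
Qed.

End multilinear.

Theorem corollary7 (R : realType) (K : numFieldType)
  (hK : real_or_complex R K)
  (k : nat) (hk : (0 < k)%N)
  (X : 'I_k -> topologicalLmodType K) (Y : topologicalLmodType K)
  (tau : forall j : 'I_k, Topological (X j))
  (htau : forall j : 'I_k, vector_topology (tau j))
  (htau_weak : forall j : 'I_k, coarser (tau j) (weak_topology (X j)))
  (BB : forall j : 'I_k, set (set (X j)))
  (hBB : forall j : 'I_k, bornology (BB j))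
  (hBB_bounded : forall (j : 'I_k) (B : set (X j)),
     BB j B -> weakly_bounded B)
  (A : (forall j : 'I_k, X j) -> Y) (hA : multilinear A) :
  continuous_on_sets tau BB A <-> unif_continuous_on_sets tau BB A.
Proof.
split=> [contA|unifA].
  apply: continuous_unif_continuous => // j B U BB_B U0.
  apply: (weakly_bounded_precompact hK) => //; first exact: hBB_bounded.
  move: U0; rewrite /zero_nbhs !nbhsE => -[G [oG G0] GU].
  by exists G => //; split => //; exact: htau_weak.
move=> B BB_B x Bx V V0; have [U U0 UV] := unifA B BB_B V V0.
by exists U => // y By Uyx; exact: UV.
Qed.
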